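(* Let $M$ be a hyperkähler manifold with twistor space $\mathcal{Z}$, let $f$ be a (smooth complex-valued) function on $\mathcal{Z}$, and let $V_N$, $V_S$, $V_{N\cap S}$ be domains in $\mathcal{Z}$ which project to $\mathbb{CP}^1$ onto $N$, $S$ and $N\cap S$, or subdomains of these, respectively. Then: (1) $f$ is holomorphic on $V_N$ if and only if $df\,P_N(\zeta)=0$ and $\bar\partial_{\mathbb{CP}^1}f=0$ on $V_N$; (2) $f$ is holomorphic on $V_S$ if and only if $df\,P_S(\tilde\zeta)=0$ and $\bar\partial_{\mathbb{CP}^1}f=0$ on $V_S$; (3) $f$ is holomorphic on $V_{N\cap S}$ if and only if $df\,I(\zeta)=0$ and $\bar\partial_{\mathbb{CP}^1}f=0$ on $V_{N\cap S}$.
   Context: A hyperkähler manifold is a smooth manifold $M$ of real dimension $4m$ with three symplectic forms $\omega_1,\omega_2,\omega_3$ such that, viewing 2-forms as bundle maps $TM\to T^*M$, the endomorphisms $I_1=\omega_3^{-1}\omega_2$, $I_2=\omega_1^{-1}\omega_3$, $I_3=\omega_2^{-1}\omega_1$ of $TM$ satisfy $I_1^2=I_2^2=I_3^2=I_1I_2I_3=-1$; the metric $g$ is given by $\omega_i(X,Y)=g(X,I_iY)$. For $\mathbf{u}=(x_1,x_2,x_3)\in S^2$, $I(\mathbf{u})=x_1I_1+x_2I_2+x_3I_3$ is an integrable complex structure on $M$. Endomorphisms of $TM$ act on vector fields from the left and on 1-forms from the right, $(\alpha I)(X)=\alpha(IX)$. Put $I_+=\tfrac12(I_1+iI_2)$,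 $I_0=I_3$, $I_-=-\tfrac12(I_1-iI_2)$. $S^2\cong\mathbb{CP}^1$ is covered by $N=S^2\setminus\{(0,0,-1)\}$ and $S=S^2\setminus\{(0,0,1)\}$, with complex coordinates $\zeta=-\frac{x_1+ix_2}{1+x_3}$ on $N$ and $\tilde\zeta=-\frac{x_1-ix_2}{1-x_3}$ on $S$ ($\tilde\zeta=1/\zeta$ on $N\cap S$). Define $P_N(\zeta)=\tfrac12(1+iI_0)+i\zeta I_-$ on $N$, $P_S(\tilde\zeta)=\tfrac12(1-iI_0)-i\tilde\zeta I_+$ on $S$, and $I(\zeta)=\frac{I_+}{\zeta}+I_0+\zeta I_-$ on $N\cap S$. The twistor space is $\mathcal{Z}=M\times S^2$ with the (integrable) complex structure acting on $T_xM\oplus T_{\mathbf{u}}S^2$ as $I(\mathbf{u})\oplus I_{\mathbb{CP}^1}$, where $I_{\mathbb{CP}^1}$ is the standard complex structure of $\mathbb{CP}^1$; $\pi:\mathcal{Z}\to\mathbb{CP}^1$ is the projection. $d$ denotes the exterior derivative in the $M$-directions (along the fibers of $\pi$), and $\bar\partial_{\mathbb{CP}^1}$ the Dolbeault operator in the $\mathbb{CP}^1$-directions (along the lines $\{x\}\times\mathbb{CP}^1$). *)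

(* Defs.v *)
From HB Require Import structures.
From mathcomp Require Import all_boot all_order all_algebra.
From mathcomp Require Import all_classical all_reals all_analysis.
From mathcomp Require Import ring lra complex.

Set Implicit Arguments.
Unset Strict Implicit.
Unset Printing Implicit Defensive.

Import Order.TTheory GRing.Theory Num.Theory.
Import numFieldNormedType.Exports.

Local Open Scope classical_set_scope.
Local Open Scope ring_scope.

(* Conventions. Points of coordinate space are row vectors.  In the
   coordinates of a chart, tangent vectors are columns and 1-forms are rows,
   so that the right action (alpha I)(X) = alpha (I X) of endomorphisms on
   1-forms is the matrix product alpha *m I.  A 2-tensor t has matrix
   t i j = t(e_i, e_j), i.e. the matrix of the bundle map X |-> t(., X); the
   other choice X |-> t(X, .) changes the sign of a 2-form and yields the same
   endomorphisms w^-1 w'.  Tensor fields are given by their components in the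
   charts of an atlas together with the transformation law. *)

Section Smoothness.
Variables (R : realType) (n : nat).

Definition partial (j : 'I_n) (g : 'rV[R]_n -> R) : 'rV[R]_n -> R :=
  fun y => 'D_(delta_mx 0 j) g y.

(* For U open: g is of class C^k on U. *)
Fixpoint Ck (k : nat) (U : set 'rV[R]_n) (g : 'rV[R]_n -> R) : Prop :=
  match k with
  | 0 => forall y, U y -> {for y, continuous g}
  | k'.+1 => (forall y, U y -> differentiable g y) /\
             (forall j, Ck k' U (partial j g))
  end.

Definition smooth (U : set 'rV[R]_n) (g : 'rV[R]_n -> R) : Prop :=
  forall k, Ck k U g.

End Smoothness.

Section Manifolds.
Variables (R : realType) (n : nat).

(* Only the values of cmap on cdom, and of cinv on the image of cdom, are
   meaningful. *)
Record coords (T : Type) := Coords {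
  cdom : set T;
  cmap : T -> 'rV[R]_n;
  cinv : 'rV[R]_n -> T }.

Definition cimg (T : Type) (c : coords T) : set 'rV[R]_n := cmap c @` cdom c.

Definition is_chart (T : topologicalType) (c : coords T) : Prop :=
  [/\ open (cdom c), open (cimg c),
      (forall x, cdom c x -> cinv c (cmap c x) = x),
      (forall x, cdom c x -> {for x, continuous (cmap c)}) &
      (forall y, cimg c y -> {for y, continuous (cinv c)})].

Definition smoothly_compatible (T : Type) (c c' : coords T) : Prop :=
  forall i : 'I_n, smooth (cmap c @` (cdom c `&` cdom c'))
    (fun y => cmap c' (cinv c y) 0 i).

Record manifold : Type := Manifold {
  mcarrier :> topologicalType;
  atlas : set (coords mcarrier);
  manifold_hausdorff : hausdorff_space mcarrier;
  manifold_second_countable : @second_countable mcarrier;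
  atlas_chart : forall c, atlas c -> is_chart c;
  atlas_cover : forall x, exists2 c, atlas c & cdom c x;
  atlas_compatible : forall c c', atlas c -> atlas c' ->
    smoothly_compatible c c' }.

Section Functions.
Variables (T : Type) (f : T -> R[i]).

Definition smooth_function (A : set (coords T)) : Prop :=
  forall c, A c -> smooth (cimg c) (fun y => complex.Re (f (cinv c y))) /\
                   smooth (cimg c) (fun y => complex.Im (f (cinv c y))).

(* Components of df at x in the coordinates c. *)
Definition dcoord (c : coords T) (x : T) : 'rV[R[i]]_n :=
  \row_j Complex (partial j (fun y => complex.Re (f (cinv c y))) (cmap c x))
                 (partial j (fun y => complex.Im (f (cinv c y))) (cmap c x)).
End Functions.

Section Tensors.
Variable M : manifold.

(* Meaningful only for a chart of the atlas and a point in its domain. *)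
Definition components : Type := coords M -> M -> 'M[R]_n.

(* The library's jacobian acts on row vectors from the right, hence is the
   transpose of the usual Jacobian matrix. *)
Definition tensor_law (t : components) : Prop :=
  forall c c' x, atlas c -> atlas c' -> cdom c x -> cdom c' x ->
  let J := jacobian (cmap c' \o cinv c) (cmap c x) in
  t c x = J *m t c' x *m J^T.

Definition smooth_components (t : components) : Prop :=
  forall c, atlas c -> forall i j, smooth (cimg c) (fun y => t c (cinv c y) i j).

Definition is_2tensor (t : components) : Prop :=
  tensor_law t /\ smooth_components t.

Definition is_2form (w : components) : Prop :=
  is_2tensor w /\
  forall c x, atlas c -> cdom c x -> (w c x)^T = - w c x.

Definition closed_2form (w : components) : Prop :=
  forall c x, atlas c -> cdom c x -> forall i j k,
  let D l p q := partial l (fun y => w c (cinv c y) p q) (cmap c x) in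
  D i j k + D j k i + D k i j = 0.

Definition symplectic (w : components) : Prop :=
  [/\ is_2form w, closed_2form w &
      forall c x, atlas c -> cdom c x -> w c x \in unitmx].

Definition riemannian (g : components) : Prop :=
  is_2tensor g /\
  forall c x, atlas c -> cdom c x ->
    (g c x)^T = g c x /\
    forall v : 'cV[R]_n, v != 0 -> 0 < (v^T *m g c x *m v) 0 0.

End Tensors.
End Manifolds.

Section Hyperkahler.
Variables (R : realType) (m : nat).

Record hyperkahler := Hyperkahler {
  hk_manifold :> manifold R (4 * m);
  omega1 : components hk_manifold;
  omega2 : components hk_manifold;
  omega3 : components hk_manifold;
  omega1_symplectic : symplectic omega1;
  omega2_symplectic : symplectic omega2;
  omega3_symplectic : symplectic omega3;
  hk_metric : components hk_manifold;
  hk_metric_riemannian : riemannian hk_metric;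
  hk_axiom : forall c x, atlas c -> cdom c x ->
    let I1 := invmx (omega3 c x) *m omega2 c x in
    let I2 := invmx (omega1 c x) *m omega3 c x in
    let I3 := invmx (omega2 c x) *m omega1 c x in
    [/\ I1 *m I1 = - 1%:M, I2 *m I2 = - 1%:M, I3 *m I3 = - 1%:M &
        I1 *m I2 *m I3 = - 1%:M] /\
    [/\ omega1 c x = hk_metric c x *m I1, omega2 c x = hk_metric c x *m I2 &
        omega3 c x = hk_metric c x *m I3] }.

Variable M : hyperkahler.

Definition I1 (c : coords R (4 * m) M) (x : M) : 'M[R]_(4 * m) :=
  invmx (omega3 c x) *m omega2 c x.
Definition I2 (c : coords R (4 * m) M) (x : M) : 'M[R]_(4 * m) :=
  invmx (omega1 c x) *m omega3 c x.
Definition I3 (c : coords R (4 * m) M) (x : M) : 'M[R]_(4 * m) :=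
  invmx (omega2 c x) *m omega1 c x.

End Hyperkahler.

Definition cplx (R : realType) (p q : nat) (A : 'M[R]_(p, q)) : 'M[R[i]]_(p, q) :=
  map_mx (fun a => Complex a 0) A.

Section Sphere.
Variable R : realType.

Definition vec3 (a b c : R) : 'rV[R]_3 := \row_j nth 0 [:: a; b; c] j.

Definition sphere_set : set 'rV[R]_3 :=
  [set v | v 0 0 ^+ 2 + v 0 1 ^+ 2 + v 0 2 ^+ 2 = 1].

Definition sphere : topologicalType := set_type sphere_set.

Definition x1 (u : sphere) : R := \val u 0 0.
Definition x2 (u : sphere) : R := \val u 0 1.
Definition x3 (u : sphere) : R := \val u 0 2.

Definition Nset : set sphere := [set u | \val u <> vec3 0 0 (-1)].
Definition Sset : set sphere := [set u | \val u <> vec3 0 0 1].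

Definition zetaN (u : sphere) : R[i] :=
  - (Complex (x1 u) (x2 u) / Complex (1 + x3 u) 0).
Definition zetaS (u : sphere) : R[i] :=
  - (Complex (x1 u) (- x2 u) / Complex (1 - x3 u) 0).

Definition reim (z : R[i]) : 'rV[R]_2 :=
  \row_j (if j == 0 then complex.Re z else complex.Im z).

(* Inverse stereographic projections: for w = (a, b) and q = 1 + a^2 + b^2,
   zeta = a + i b at (-2a/q, -2b/q, (1 - a^2 - b^2)/q), and
   zeta~ = a + i b at (-2a/q, 2b/q, (a^2 + b^2 - 1)/q). *)
Definition stereoN_vec (w : 'rV[R]_2) : 'rV[R]_3 :=
  let a := w 0 0 in let b := w 0 1 in let q := 1 + a ^+ 2 + b ^+ 2 in
  vec3 (- 2 * a / q) (- 2 * b / q) ((1 - a ^+ 2 - b ^+ 2) / q).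
Definition stereoS_vec (w : 'rV[R]_2) : 'rV[R]_3 :=
  let a := w 0 0 in let b := w 0 1 in let q := 1 + a ^+ 2 + b ^+ 2 in
  vec3 (- 2 * a / q) (2 * b / q) ((a ^+ 2 + b ^+ 2 - 1) / q).

Lemma stereo_denom_neq0 (a b : R) : 1 + a ^+ 2 + b ^+ 2 != 0.
Proof. by rewrite gt_eqF // -addrA ltr_pwDl // addr_ge0 // sqr_ge0. Qed.

Lemma stereoN_sphere w : sphere_set (stereoN_vec w).
Proof.
rewrite /sphere_set /= !mxE /=.
by field; rewrite stereo_denom_neq0.
Qed.

Lemma stereoS_sphere w : sphere_set (stereoS_vec w).
Proof.
rewrite /sphere_set /= !mxE /=.
by field; rewrite stereo_denom_neq0.
Qed.

Definition chartN : coords R 2 sphere :=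
  Coords Nset (fun u => reim (zetaN u))
    (fun w => exist _ (stereoN_vec w) (mem_set (stereoN_sphere w))).
Definition chartS : coords R 2 sphere :=
  Coords Sset (fun u => reim (zetaS u))
    (fun w => exist _ (stereoS_vec w) (mem_set (stereoS_sphere w))).

Definition sphere_atlas : set (coords R 2 sphere) := [set chartN; chartS].

(* Multiplication by i in either holomorphic coordinate a + i b; well defined
   because zeta~ = 1 / zeta is holomorphic. *)
Definition I_CP1 : 'M[R]_2 :=
  \matrix_(i, j) (if (i == 0) && (j == 1) then - 1
                  else if (i == 1) && (j == 0) then 1 else 0).

End Sphere.

Section TwistorSpace.
Variables (R : realType) (m : nat) (M : hyperkahler R m).

Definition twistor : topologicalType := (M * sphere R)%type.

Definition prod_coords (c : coords R (4 * m) M) (s : coords R 2 (sphere R)) :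
    coords R (4 * m + 2) twistor :=
  Coords (cdom c `*` cdom s)
    (fun p : twistor => row_mx (cmap c p.1) (cmap s p.2))
    (fun y => (cinv c (lsubmx y), cinv s (rsubmx y))).

Definition twistor_atlas : set (coords R (4 * m + 2) twistor) :=
  [set e | exists c s, [/\ atlas c, sphere_atlas s & e = prod_coords c s]].

Definition I_sphere (c : coords R (4 * m) M) (x : M) (u : sphere R) :
    'M[R]_(4 * m) :=
  x1 u *: I1 c x + x2 u *: I2 c x + x3 u *: I3 c x.

Definition I_twistor (c : coords R (4 * m) M) (p : twistor) :
    'M[R]_(4 * m + 2) :=
  block_mx (I_sphere c p.1 p.2) 0 0 (I_CP1 R).

(* Cauchy-Riemann equations df o J = i df for the complex structure of the
   twistor space. *)
Definition holomorphic_on (V : set twistor) (f : twistor -> R[i]) : Prop :=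
  forall p, V p -> forall c s, atlas c -> sphere_atlas s ->
    cdom (prod_coords c s) p ->
    dcoord f (prod_coords c s) p *m cplx (I_twistor c p) =
    'i%C *: dcoord f (prod_coords c s) p.

Definition domain (V : set twistor) : Prop := [/\ open V, connected V & V !=set0].

(* Components along M of df. *)
Definition d_fiber (f : twistor -> R[i]) (c : coords R (4 * m) M)
    (p : twistor) : 'rV[R[i]]_(4 * m) :=
  dcoord (fun x => f (x, p.2)) c p.1.

(* Coefficient of the (0,1)-form, (d/da + i d/db) / 2 in the coordinate a + i b. *)
Definition dbar_CP1 (f : twistor -> R[i]) (s : coords R 2 (sphere R))
    (p : twistor) : R[i] :=
  let D := dcoord (fun u => f (p.1, u)) s p.2 in
  (D 0 0 + 'i%C * D 0 1) / 2.

Definition dbar_CP1_eq0 (V : set twistor) (f : twistor -> R[i]) : Prop :=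
  forall p, V p -> forall s, sphere_atlas s -> cdom s p.2 -> dbar_CP1 f s p = 0.

(* df P = 0 on V, for an endomorphism field P of the complexified TM that
   depends on the point of the sphere. *)
Definition d_fiber_mul_eq0 (V : set twistor) (f : twistor -> R[i])
    (P : coords R (4 * m) M -> M -> sphere R -> 'M[R[i]]_(4 * m)) : Prop :=
  forall p, V p -> forall c, atlas c -> cdom c p.1 ->
    d_fiber f c p *m P c p.1 p.2 = 0.

Section Endomorphisms.
Variables (c : coords R (4 * m) M) (x : M).

Definition Iplus : 'M[R[i]]_(4 * m) :=
  2^-1 *: (cplx (I1 c x) + 'i%C *: cplx (I2 c x)).
Definition Izero : 'M[R[i]]_(4 * m) := cplx (I3 c x).
Definition Iminus : 'M[R[i]]_(4 * m) :=
  - (2^-1 *: (cplx (I1 c x) - 'i%C *: cplx (I2 c x))).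

Definition P_N (z : R[i]) : 'M[R[i]]_(4 * m) :=
  2^-1 *: (1%:M + 'i%C *: Izero) + ('i%C * z) *: Iminus.
Definition P_S (z : R[i]) : 'M[R[i]]_(4 * m) :=
  2^-1 *: (1%:M - 'i%C *: Izero) - ('i%C * z) *: Iplus.
Definition I_zeta (z : R[i]) : 'M[R[i]]_(4 * m) :=
  z^-1 *: Iplus + Izero + z *: Iminus.
End Endomorphisms.

End TwistorSpace.

(* Main.v *)
Require Import Defs.
From mathcomp Require Import all_boot all_order all_algebra.
From mathcomp Require Import all_classical all_reals all_analysis.
From mathcomp Require Import complex.
From mathcomp Require Import ring.

Set Implicit Arguments.
Unset Strict Implicit.
Unset Printing Implicit Defensive.

Import GRing.Theory Num.Theory.
Local Open Scope classical_set_scope.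
Local Open Scope ring_scope.

(** At a point [(x, u)] the complex structure of the twistor space is
    block-diagonal, so the Cauchy-Riemann equations in a product chart split
    into an equation along the sphere, which is dbar f = 0, and the equation
    [df I(u) = i df] along [M] ([holomorphic_on_split]).  The latter says that
    the 1-form [df] vanishes on the image of [1 + i I(u)], which is the space
    of vectors of type (0,1) for [I(u)].  It remains to see that [P_N], [P_S]
    and [I_zeta] have that same image.

    This is quaternion algebra in the fibre.  Two endomorphisms have the same
    image, hence are annihilated by the same 1-forms, as soon as each is a right
    multiple of the other.  For [P = P_N(zeta)] and [T = 1 + i I(u)] one has
    [P T = T] and [T P = 2 P] ([qproj_factor]): [P] is a projection onto
    the (0,1)-vectors.  Off [zeta = 0] one has
    [P = zeta I(zeta) I_-] and [I(zeta) = P (I_+ / zeta - i)]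
    ([qzeta_factor]).  The southern case is the northern one for the
    quaternionic triple [(I1, -I2, -I3)] and the point [(x1, -x2, -x3)]: this
    exchanges [zeta] with [zeta~], [I_-] with [- I_+] and fixes [I(u)]. *)

(** * Quaternionic triples of matrices *)

Section Quaternions.
Variables (F : fieldType) (n : nat).
Implicit Types (A B C : 'M[F]_n) (D : 'rV[F]_n).

Definition quaternionic A B C : Prop :=
  [/\ A *m A = - 1%:M, B *m B = - 1%:M, C *m C = - 1%:M &
      A *m B *m C = - 1%:M].

Lemma quaternionic_mul A B C : quaternionic A B C ->
  [/\ A *m B = C, B *m C = A & C *m A = B] /\
  [/\ B *m A = - C, C *m B = - A & A *m C = - B].
Proof.
case=> AA BB CC ABC.
have AB : A *m B = C.
  apply: oppr_inj.
  by rewrite -[LHS]mulmx1 mulNmx -mulmxN -CC mulmxA ABC mulNmx mul1mx.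
have BC : B *m C = A.
  apply: oppr_inj; rewrite -[LHS]mul1mx mulmxN -mulNmx -AA -mulmxA.
  by rewrite (mulmxA A B) ABC mulmxN mulmx1.
have BA : B *m A = - C by rewrite -BC mulmxA BB mulNmx mul1mx.
have AC : A *m C = - B by rewrite -AB mulmxA AA mulNmx mul1mx.
have CB : C *m B = - A by rewrite -AB -mulmxA BB mulmxN mulmx1.
have CA : C *m A = B.
  by rewrite -BC mulmxA CB mulNmx AC opprK.
by [].
Qed.

(** The half-turn about the axis of [A] preserves the quaternion relations; it
    carries the northern formulas to the southern ones. *)
Lemma quaternionic_flip A B C :
  quaternionic A B C -> quaternionic A (- B) (- C).
Proof.
by case=> AA BB CC ABC; split; rewrite // !(mulmxN, mulNmx) opprK.
Qed.

Lemma mulmx_eq0_image D A B A' B' :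
  A = B *m B' -> B = A *m A' -> D *m A = 0 <-> D *m B = 0.
Proof.
move=> AE BE; split=> D0; [rewrite BE|rewrite AE];
by rewrite mulmxA D0 mul0mx.
Qed.

Variables (i : F) (ii : i * i = -1) (two : (2 : F) != 0).

(** [qplus], [qminus], [qproj] and [qzeta] are the formulas of [Iplus],
    [Iminus], [P_N] and [I_zeta] for an arbitrary triple, so that [P_S] is also
    an instance, for the triple turned by [quaternionic_flip]. *)
Definition qplus A B := 2^-1 *: (A + i *: B).
Definition qminus A B := - (2^-1 *: (A - i *: B)).
Definition qproj A B C (w : F) :=
  2^-1 *: (1%:M + i *: C) + (i * w) *: qminus A B.
Definition qzeta A B C (w : F) :=
  w^-1 *: qplus A B + C + w *: qminus A B.

Let expand := (mulmxDl, mulmxDr, mulmxBl, mulmxBr, mulmxN, mulNmx,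
  =^~ scalemxAl, =^~ scalemxAr, mulmx1, mul1mx).

(** Both [T / 2] and [qproj A B C w] are projections onto the vectors on which
    [x A + y B + z C] is [- i]; the projections differ, but each one is the
    identity on the image of the other. *)
Lemma qproj_factor A B C (x y z : F) : quaternionic A B C ->
  x ^+ 2 + y ^+ 2 + z ^+ 2 = 1 -> 1 + z != 0 ->
  let w := - ((x + i * y) / (1 + z)) in
  let T := 1%:M + i *: (x *: A + y *: B + z *: C) in
  qproj A B C w *m T = T /\ T *m qproj A B C w = 2 *: qproj A B C w.
Proof.
move=> q sph z1 w T.
(* With r = x - i y the point of the sphere depends polynomially on (w, r),
   so that the identities below involve no relation besides i^2 = -1. *)
pose r := x - i * y.
have e1 : w * (1 + z) = - (x + i * y) by rewrite /w mulNr divfK.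
have xyE : (x + i * y) * r = (1 - z) * (1 + z).
  by rewrite -subr_sqr expr1n -sph /r; ring: ii.
have e2 : w * r = z - 1 by rewrite /w mulNr mulrAC xyE mulfK // opprB.
have zE : z = 1 + w * r by rewrite e2; ring.
have pE : x + i * y = - (w * (2 + w * r)) by rewrite -[LHS]opprK -e1 zE; ring.
have xE : x = 2^-1 * (r - w * (2 + w * r)) by rewrite -pE /r; field.
have yE : y = 2^-1 * i * (r + w * (2 + w * r)).
  by rewrite -[w * (2 + _)]opprK -pE /r; field: ii.
have [AA BB CC _] := q.
have [[AB BC CA] [BA CB AC]] := quaternionic_mul q.
rewrite /T /qproj /qminus !expand AA BB CC AB BC CA BA CB AC.
move: w r zE xE yE {T e1 xyE e2 pE z1 sph} => w r -> -> ->.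
split; apply/matrixP => k l; rewrite !mxE;
move: (A k l) (B k l) (C k l) (_ == _)%:R => a b e d; by field: ii.
Qed.

(** The nilpotent [qzeta A B C w] has the same image as the projection
    [qproj A B C w].  The right factors come from two products,
    [qplus *m qminus = (1 + i C) / 2] and
    [qproj *m qplus = qplus + w (i + C) / 2]. *)
Lemma qzeta_factor A B C (w : F) : quaternionic A B C -> w != 0 ->
  qproj A B C w = qzeta A B C w *m (w *: qminus A B) /\
  qzeta A B C w = qproj A B C w *m (w^-1 *: qplus A B - i *: 1%:M).
Proof.
move=> q w0; have [AA BB _ _] := q.
have [[AB BC CA] [BA CB AC]] := quaternionic_mul q.
rewrite /qzeta /qproj /qplus /qminus !expand AA BB AB CA BA CB.
split; apply/matrixP => k l; rewrite !mxE;
move: (A k l) (B k l) (C k l) (_ == _)%:R => a b e d;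
by field: ii; rewrite ?two ?w0.
Qed.

(** Since [i^2 = -1], the equation [D J = i D] says that the row [D] kills the
    image of [1 + i J], which is the image of [qproj] by [qproj_factor]. *)
Lemma type10_qproj A B C D (x y z : F) : quaternionic A B C ->
  x ^+ 2 + y ^+ 2 + z ^+ 2 = 1 -> 1 + z != 0 ->
  D *m (x *: A + y *: B + z *: C) = i *: D <->
  D *m qproj A B C (- ((x + i * y) / (1 + z))) = 0.
Proof.
move=> q sph z1; have [PT TP] := qproj_factor q sph z1.
set P := qproj A B C _ in PT TP *; set T := 1%:M + _ in PT TP.
have PE : P = T *m (2^-1 *: P) by rewrite -scalemxAr TP scalerA mulVf ?scale1r.
rewrite -(mulmx_eq0_image D (esym PT) PE) /T mulmxDr mulmx1 -scalemxAr.
set DI := D *m _; split=> [->|/(congr1 ( *:%R i))].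
  by rewrite scalerA ii scaleN1r subrr.
by rewrite scaler0 scalerDr scalerA ii scaleN1r => /subr0_eq.
Qed.

Lemma mul_qzeta_eq0 A B C D (w : F) : quaternionic A B C -> w != 0 ->
  D *m qzeta A B C w = 0 <-> D *m qproj A B C w = 0.
Proof.
move=> q w0; have [PE QE] := qzeta_factor q w0.
exact: mulmx_eq0_image QE PE.
Qed.

Lemma qproj_flip A B C (w : F) : qproj A (- B) (- C) w =
  2^-1 *: (1%:M - i *: C) - (i * w) *: qplus A B.
Proof. by rewrite /qproj /qminus /qplus !scalerN opprK. Qed.

End Quaternions.

(** * The differential in a product chart *)

Section ProductCharts.

(** A partial derivative is a limit along a line, and a line in a direction of
    one factor stays in a slice of the product. *)
Lemma partial_lshift (R : realType) p q (g : 'rV[R]_(p + q) -> R) j a b :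
  partial (lshift q j) g (row_mx a b) = partial j (fun y => g (row_mx y b)) a.
Proof.
rewrite /partial /derive.
apply: (congr1 (fun F : R^o -> R^o => lim (F @ (0 : R^o)^'))).
apply/funext => h /=; congr (_ *: (g _ - _)).
by rewrite delta_mx_lshift scale_row_mx add_row_mx scaler0 add0r.
Qed.

Lemma partial_rshift (R : realType) p q (g : 'rV[R]_(p + q) -> R) j a b :
  partial (rshift p j) g (row_mx a b) = partial j (fun y => g (row_mx a y)) b.
Proof.
rewrite /partial /derive.
apply: (congr1 (fun F : R^o -> R^o => lim (F @ (0 : R^o)^'))).
apply/funext => h /=; congr (_ *: (g _ - _)).
by rewrite delta_mx_rshift scale_row_mx add_row_mx scaler0 add0r.
Qed.

Variables (R : realType) (m : nat) (M : hyperkahler R m).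
Variables (f : twistor M -> R[i]).

(** The slices of [f] in the product chart pass through
    [cinv c (cmap c p.1)] and [cinv s (cmap s p.2)], whence the
    two hypotheses. *)
Lemma dcoord_prod (c : coords R (4 * m) M) (s : coords R 2 (sphere R))
    (p : twistor M) :
  cinv c (cmap c p.1) = p.1 -> cinv s (cmap s p.2) = p.2 ->
  dcoord f (prod_coords c s) p =
  row_mx (d_fiber f c p) (dcoord (fun u => f (p.1, u)) s p.2).
Proof.
move=> cK sK; rewrite -[LHS]hsubmxK.
congr row_mx; apply/rowP => j; rewrite !mxE.
  rewrite !partial_lshift /=; congr (Complex (partial j _ _) (partial j _ _));
  by apply/funext => y /=; rewrite row_mxKl row_mxKr sK.
rewrite !partial_rshift /=; congr (Complex (partial j _ _) (partial j _ _));
by apply/funext => y /=; rewrite row_mxKl row_mxKr cK.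
Qed.

End ProductCharts.

(** * The sphere *)

Section Sphere.
Variable R : realType.
Implicit Type u : sphere R.

Lemma sphereE u : x1 u ^+ 2 + x2 u ^+ 2 + x3 u ^+ 2 = 1.
Proof. by case: u => v vS; exact: (set_mem vS). Qed.

Lemma vec3E u : \val u = vec3 (x1 u) (x2 u) (x3 u).
Proof.
apply/rowP => -[[|[|[|//]]] ?]; rewrite mxE /=;
by congr (\val u _ _); apply/val_inj.
Qed.

(** A third coordinate of square [1] forces the other two to vanish, so that a
    pole is recognised by its height. *)
Lemma poleP u (e : R) : e ^+ 2 = 1 -> \val u <> vec3 0 0 e <-> x3 u <> e.
Proof.
move=> e1; split; apply: contra_not; last by rewrite /x3 => ->; rewrite mxE.
move=> x3e.
have := sphereE u; rewrite x3e e1 -[X in _ = X]add0r => /addIr/eqP.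
rewrite paddr_eq0 ?sqr_ge0 // !sqrf_eq0 => /andP[/eqP x0 /eqP y0].
by rewrite vec3E x0 y0 x3e.
Qed.

Lemma NsetP u : Nset u <-> 1 + x3 u != 0.
Proof.
rewrite /Nset /= poleP ?sqrrN ?expr1n // addrC addr_eq0.
by split=> /eqP.
Qed.

Lemma SsetP u : Sset u <-> 1 - x3 u != 0.
Proof.
rewrite /Sset /= poleP ?expr1n // subr_eq0 eq_sym.
by split=> /eqP.
Qed.

Lemma zetaNE u : zetaN u =
  - (((x1 u)%:C%C + 'i%C * (x2 u)%:C%C) / (1 + (x3 u)%:C%C)).
Proof.
rewrite /zetaN [Complex (x1 u) _]complexE.
by rewrite -(rmorph1 (real_complex R)) -rmorphD.
Qed.

Lemma zetaSE u : zetaS u =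
  - (((x1 u)%:C%C + 'i%C * (- x2 u)%:C%C) / (1 + (- x3 u)%:C%C)).
Proof.
rewrite /zetaS [Complex (x1 u) _]complexE.
by rewrite -(rmorph1 (real_complex R)) -rmorphD.
Qed.

(** Off the poles the numerator [x1 + i x2] is nonzero, because
    [x1^2 + x2^2 = (1 - x3) (1 + x3)]. *)
Lemma zetaN_neq0 u : Nset u -> Sset u -> zetaN u != 0.
Proof.
move=> /NsetP n /SsetP s; rewrite oppr_eq0 mulf_neq0 ?invr_eq0 //; last first.
  by apply: contra_neq n => -[].
have : x1 u ^+ 2 + x2 u ^+ 2 != 0.
  have -> : x1 u ^+ 2 + x2 u ^+ 2 = (1 - x3 u) * (1 + x3 u).
    by rewrite -subr_sqr expr1n -(sphereE u) addrK.
  exact: mulf_neq0.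
by apply: contra_neq => -[-> ->]; rewrite !expr0n addr0.
Qed.

Lemma opp_div_real (a b c : R) :
  - (Complex a b / Complex c 0) = Complex (- (a / c)) (- (b / c)).
Proof.
rewrite -[Complex c 0]/(c%:C%C) -(fmorphV (real_complex R)).
rewrite [LHS]/(- Complex _ _).
by rewrite !mulr0 subr0 add0r.
Qed.

(** By the equation of the sphere the denominator [1 + |zeta|^2] of the inverse
    stereographic projection is [2 / (1 + x3)], and in the southern chart
    [2 / (1 - x3)]; with these values the coordinates of [u] come back. *)
Lemma sphere_chartK u s : sphere_atlas s -> cdom s u -> cinv s (cmap s u) = u.
Proof.
have sph := sphereE u.
have uE x y z : x = x1 u -> y = x2 u -> z = x3 u -> vec3 x y z = \val u.
  by move=> -> -> ->; rewrite -vec3E.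
have y2 : x2 u ^+ 2 = 1 - x1 u ^+ 2 - x3 u ^+ 2 by rewrite -sph; ring.
case=> -> /=.
  move=> /NsetP n; apply/val_inj.
  rewrite /= /zetaN opp_div_real /stereoN_vec !mxE /=.
  have q : 1 + (- (x1 u / (1 + x3 u))) ^+ 2 + (- (x2 u / (1 + x3 u))) ^+ 2 =
      2 / (1 + x3 u).
    by field: y2.
  by apply: uE; rewrite ?q; field: y2.
move=> /SsetP n; apply/val_inj.
rewrite /= /zetaS opp_div_real mulNr opprK /stereoS_vec !mxE /=.
have q : 1 + (- (x1 u / (1 - x3 u))) ^+ 2 + (x2 u / (1 - x3 u)) ^+ 2 =
    2 / (1 - x3 u).
  by field: y2.
by apply: uE; rewrite ?q; field: y2.
Qed.

Lemma sphere_atlas_cover u : exists2 s, sphere_atlas s & cdom s u.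
Proof.
have [n|] := boolP (1 + x3 u != 0).
  by exists (chartN R); [left|apply/NsetP].
move=> /negPn s; exists (chartS R); [by right|apply/SsetP].
move: s; rewrite addrC addr_eq0 => /eqP ->.
by rewrite opprK.
Qed.

End Sphere.

(** * Splitting the Cauchy-Riemann equations *)

Section Splitting.
Variables (R : realType) (m : nat) (M : hyperkahler R m).
Variables (f : twistor M -> R[i]).

(** Exhibits [cplx] as the base change along a ring morphism, to which the
    [map_mx] lemmas apply. *)
Lemma cplxE (p q : nat) (A : 'M[R]_(p, q)) : cplx A = map_mx (real_complex R) A.
Proof. by []. Qed.

Lemma mul_I_CP1 (D : 'rV[R[i]]_2) :
  D *m cplx (I_CP1 R) = 'i%C *: D <-> (D 0 0 + 'i%C * D 0 1) / 2 = 0.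
Proof.
have ii : 'i%C * 'i%C = -1 :> R[i] by rewrite -expr2 sqr_i.
have -> : D *m cplx (I_CP1 R) = \row_j (if j == 0 then D 0 1 else - D 0 0).
  apply/rowP => j; rewrite !mxE big_ord_recl big_ord1 !mxE.
  rewrite (_ : lift ord0 ord0 = 1); last exact/val_inj.
  case: j => -[|[|//]] lj /=; first by rewrite mulr0 add0r mulr1.
  by rewrite [Complex (-1) 0](rmorphN1 (real_complex R)) mulr0 addr0 mulrN1.
split=> [/rowP E|E].
  have := E 0; rewrite !mxE /= => ->.
  by rewrite mulrA ii mulN1r subrr mul0r.
have {}E : D 0 0 = - ('i%C * D 0 1).
  apply/eqP; rewrite -addr_eq0; move/eqP: E.
  by rewrite mulf_eq0 invr_eq0 pnatr_eq0 orbF.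
apply/rowP => j; rewrite !mxE; case: eqP => [->|j1].
  by rewrite E mulrN mulrA ii mulN1r opprK.
have -> : j = 1 by case: j j1 => -[|[|//]] lj j1; [case: j1|]; exact/val_inj.
by rewrite E opprK.
Qed.

(** The complex structure is block-diagonal in product charts, so each
    Cauchy-Riemann equation is a pair of equations, one depending only on the
    chart of [M] and the other only on the chart of the sphere.  Since both
    atlases cover, the two may be quantified over separately. *)
Lemma holomorphic_on_split (V : set (twistor M)) :
  holomorphic_on V f <->
  (forall p, V p -> forall c, atlas c -> cdom c p.1 ->
     d_fiber f c p *m cplx (I_sphere c p.1 p.2) = 'i%C *: d_fiber f c p) /\
  dbar_CP1_eq0 V f.
Proof.
pose CR (p : twistor M) (c : coords R (4 * m) M) (s : coords R 2 (sphere R)) :=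
  d_fiber f c p *m cplx (I_sphere c p.1 p.2) = 'i%C *: d_fiber f c p /\
  dbar_CP1 f s p = 0.
have crE p c s : atlas c -> sphere_atlas s -> cdom c p.1 -> cdom s p.2 ->
    dcoord f (prod_coords c s) p *m cplx (I_twistor c p) =
    'i%C *: dcoord f (prod_coords c s) p <-> CR p c s.
  move=> ca sa cp sp.
  have [_ _ cK _ _] := atlas_chart ca.
  rewrite dcoord_prod ?cK ?sphere_chartK // /CR /dbar_CP1 -mul_I_CP1.
  rewrite /I_twistor !cplxE map_block_mx !map_mx0.
  rewrite mul_row_block !mulmx0 addr0 add0r.
  rewrite scale_row_mx; split=> [/eq_row_mx[]|[-> ->]] //.
split=> [hol|[dM dS] p Vp c s ca sa [cp sp]]; last first.
  by apply/crE => //; split; [exact: dM|exact: dS].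
split=> [p Vp c ca cp|p Vp s sa sp].
  have [s sa sp] := sphere_atlas_cover p.2.
  by have /crE[] : _ := hol p Vp c s ca sa (conj cp sp).
have [c ca cp] := atlas_cover p.1.
by have /crE[] : _ := hol p Vp c s ca sa (conj cp sp).
Qed.

End Splitting.

(** * Vectors of type (0,1) of the complex structures [I(u)] *)

Section Type10.
Variables (R : realType) (m : nat) (M : hyperkahler R m).
Variables (c : coords R (4 * m) M) (x : M) (D : 'rV[R[i]]_(4 * m)).
Hypotheses (ac : atlas c) (cx : cdom c x).

Let ii : 'i%C * 'i%C = -1 :> R[i]. Proof. by rewrite -expr2 sqr_i. Qed.
Let two : (2 : R[i]) != 0. Proof. by rewrite pnatr_eq0. Qed.

Lemma quaternionic_I :
  quaternionic (cplx (I1 c x)) (cplx (I2 c x)) (cplx (I3 c x)).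
Proof.
have [[q1 q2 q3 q123] _] := hk_axiom ac cx.
rewrite !cplxE; split; rewrite -!map_mxM ?q1 ?q2 ?q3 ?q123;
by rewrite map_mxN map_mx1.
Qed.

Lemma cplx_I_sphere u : cplx (I_sphere c x u) =
  (x1 u)%:C%C *: cplx (I1 c x) + (x2 u)%:C%C *: cplx (I2 c x)
  + (x3 u)%:C%C *: cplx (I3 c x).
Proof. by rewrite /I_sphere !cplxE !map_mxD !map_mxZ. Qed.

Lemma sphereE_cplx u :
  (x1 u)%:C%C ^+ 2 + (x2 u)%:C%C ^+ 2 + (x3 u)%:C%C ^+ 2 = 1 :> R[i].
Proof. by rewrite -!rmorphXn -!rmorphD /= sphereE. Qed.

Lemma type10_P_N u : Nset u ->
  D *m cplx (I_sphere c x u) = 'i%C *: D <-> D *m P_N c x (zetaN u) = 0.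
Proof.
move=> /NsetP n; rewrite cplx_I_sphere zetaNE.
apply: (type10_qproj ii two _ quaternionic_I (sphereE_cplx u)).
by rewrite -(rmorph1 (real_complex R)) -rmorphD fmorph_eq0.
Qed.

(** The point [(x1, - x2, - x3)] and the triple [(I1, - I2, - I3)] give the same
    [I(u)], and the northern coordinate of that point is the southern
    coordinate of [u]. *)
Lemma type10_P_S u : Sset u ->
  D *m cplx (I_sphere c x u) = 'i%C *: D <-> D *m P_S c x (zetaS u) = 0.
Proof.
move=> /SsetP n; rewrite cplx_I_sphere zetaSE /P_S -[Izero c x]/(cplx (I3 c x)).
rewrite -[Iplus c x]/(qplus 'i%C (cplx (I1 c x)) (cplx (I2 c x))) -qproj_flip.
have -> : (x2 u)%:C%C *: cplx (I2 c x) = (- x2 u)%:C%C *: - cplx (I2 c x).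
  by rewrite rmorphN scaleNr scalerN opprK.
have -> : (x3 u)%:C%C *: cplx (I3 c x) = (- x3 u)%:C%C *: - cplx (I3 c x).
  by rewrite rmorphN scaleNr scalerN opprK.
apply: (type10_qproj ii two _ (quaternionic_flip quaternionic_I)).
  by rewrite !rmorphN !sqrrN sphereE_cplx.
by rewrite -(rmorph1 (real_complex R)) -rmorphD fmorph_eq0.
Qed.

Lemma type10_I_zeta u : Nset u -> Sset u ->
  D *m cplx (I_sphere c x u) = 'i%C *: D <-> D *m I_zeta c x (zetaN u) = 0.
Proof.
move=> nu su; have PE := type10_P_N nu.
have QE := mul_qzeta_eq0 ii two D quaternionic_I (zetaN_neq0 nu su).
exact (iff_trans PE (iff_sym QE)).
Qed.

End Type10.

Section Holomorphy.
Variables (R : realType) (m : nat) (M : hyperkahler R m).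
Variable f : twistor M -> R[i].

Lemma holomorphic_on_mul_eq0 (V : set (twistor M)) (U : set (sphere R))
    (P : coords R (4 * m) M -> M -> sphere R -> 'M[R[i]]_(4 * m)) :
  (forall c x u (D : 'rV_(4 * m)), atlas c -> cdom c x -> U u ->
    D *m cplx (I_sphere c x u) = 'i%C *: D <-> D *m P c x u = 0) ->
  snd @` V `<=` U ->
  holomorphic_on V f <-> d_fiber_mul_eq0 V f P /\ dbar_CP1_eq0 V f.
Proof.
move=> UP VU; have VUp p : V p -> U p.2 by move=> Vp; apply: VU; exists p.
rewrite holomorphic_on_split; split=> -[dM dS]; split=> // p Vp c ac cp.
  by apply/UP => //; [exact: VUp|exact: dM].
by apply/UP; [exact: ac|exact: cp|exact: VUp|exact: dM].
Qed.

End Holomorphy.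

Theorem proposition3 (R : realType) (m : nat) (M : hyperkahler R m)
    (f : twistor M -> R[i]) (hf : smooth_function f (@twistor_atlas R m M))
    (VN VS VNS : set (twistor M))
    (domVN : domain VN) (projVN : snd @` VN `<=` @Nset R)
    (domVS : domain VS) (projVS : snd @` VS `<=` @Sset R)
    (domVNS : domain VNS) (projVNS : snd @` VNS `<=` @Nset R `&` @Sset R) :
  [/\ holomorphic_on VN f <->
        d_fiber_mul_eq0 VN f (fun c x u => P_N c x (zetaN u)) /\
        dbar_CP1_eq0 VN f,
      holomorphic_on VS f <->
        d_fiber_mul_eq0 VS f (fun c x u => P_S c x (zetaS u)) /\
        dbar_CP1_eq0 VS f
    & holomorphic_on VNS f <->
        d_fiber_mul_eq0 VNS f (fun c x u => I_zeta c x (zetaN u)) /\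
        dbar_CP1_eq0 VNS f].
Proof.
split; (apply: holomorphic_on_mul_eq0; last eassumption) => c x u D ac cx.
- exact: type10_P_N.
- exact: type10_P_S.
- by case=> nu su; exact: type10_I_zeta.
Qed.
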